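(* Let $M$ and $n$ be positive integers. (a) Let $W$ be the constant word of length $n$, with associated spacing variables $\tau_k$. Then $W$ is $M$-seen in $Y$ if and only if $\tau_k\le M$ for all $1\le k\le n$. (b) Let $W=A_n=(1,0,1,0,\dots)$ be the alternating word of length $n$, with associated variables $T_k$. Then $A_n$ is $M$-seen in $Y$ if and only if $$T_k\le kM\ \text{ for all }1\le k\le n\quad\text{and}\quad T_k-T_j<(k-j+1)M\ \text{ for all }0\le j<k\le n .$$
   Context: $Y=(Y_1,Y_2,\dots)$ is an i.i.d. sequence of Bernoulli random variables with $P(Y_j=1)=\tfrac12$. A word $W=(w_1,\dots,w_n)\in\{0,1\}^n$ is $M$-seen in $Y$ if there are integers $m_1,\dots,m_n$ such that, with $m_0=0$, $1\le m_i-m_{i-1}\le M$ and $Y_{m_i}=w_i$ for all $1\le i\le n$. Given $W$, define $T_0=0$ and recursively $T_{k+1}=\min\{i>T_k: Y_i=w_{k+1}\}$, $\tau_{k+1}=T_{k+1}-T_k$, for $0\le k<n$ (almost surely all these are finite, and the statements are understood on that event). A constant word is one of the form $(a,a,\dots,a)$ with $a\in\{0,1\}$. *)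

(* Defs.v *)
From HB Require Import structures.
From mathcomp Require Import all_boot all_order all_algebra.
From mathcomp Require Import all_classical all_reals all_analysis.

Set Implicit Arguments.
Unset Strict Implicit.
Unset Printing Implicit Defensive.

Import Order.TTheory GRing.Theory Num.Theory.

Local Open Scope classical_set_scope.

Definition mutually_independent (d d' : measure_display)
    (T : measurableType d) (E : measurableType d') (R : realType)
    (P : probability T R) (I : choiceType) (D : set I)
    (X : I -> {RV P >-> E}) : Prop :=
  forall (s : seq I) (B : I -> set E),
    uniq s -> [set` s] `<=` D -> (forall j, measurable (B j)) ->
    P (\big[setI/setT]_(j <- s) (X j @^-1` B j)) =
      (\prod_(j <- s) P (X j @^-1` B j))%E.

(* Sequences y are indexed from 1: the value y 0 is never read below.
   A word w has its letter w_(i+1) at position i of the tuple; the default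
   value of [nth] is never read at a position smaller than n. *)

(* The condition 1 <= m i.+1 - m i rules out truncation of the subtraction,
   so that natural number positions are the same as integer ones. *)
Definition M_seen (M n : nat) (w : n.-tuple bool) (y : nat -> bool) : Prop :=
  exists m : nat -> nat,
    m 0 = 0 /\
    forall i, i < n ->
      1 <= m i.+1 - m i <= M /\ y (m i.+1) = nth false w i.

(* min {i > m : y i = b}, or None if this set is empty *)
Definition first_after (y : nat -> bool) (b : bool) (m : nat) : option nat :=
  match pselect (exists i, (m < i) && (y i == b)) with
  | left ex => Some (ex_minn ex)
  | right _ => None
  end.

Fixpoint hitting (n : nat) (w : n.-tuple bool) (y : nat -> bool) (k : nat)
    : option nat :=
  if k is k'.+1 then obind (first_after y (nth false w k')) (hitting w y k')
  else Some 0.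

Definition hitting_finite (n : nat) (w : n.-tuple bool) (y : nat -> bool)
    : Prop :=
  forall k, k <= n -> hitting w y k <> None.

(* T_k, meaningful where [hitting_finite] holds *)
Definition hitting_time (n : nat) (w : n.-tuple bool) (y : nat -> bool)
    (k : nat) : nat :=
  odflt 0 (hitting w y k).

(* tau_k for 1 <= k <= n; the subtraction is not truncated since T is
   increasing where [hitting_finite] holds *)
Definition spacing (n : nat) (w : n.-tuple bool) (y : nat -> bool) (k : nat)
    : nat :=
  hitting_time w y k - hitting_time w y k.-1.

Definition constant_word (n : nat) (a : bool) : n.-tuple bool :=
  [tuple a | _ < n].

Definition alternating_word (n : nat) : n.-tuple bool :=
  [tuple ~~ odd i | i < n].

(* Main.v *)
(* In the alternating case T_1 < T_2 < ... are the starting points of the runs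
   of y.  Each step of an embedding m has to leave its current run, so from the
   first m_i >= T_j onwards it gains at least one run per step, hence
   T_k <= m_(i+k-j) <= T_j + (k-j+1)M - 1.  Conversely the backward recursion
   m_n = T_n, m_k = max(T_k, m_(k+1) - M) is solved by
   m_k = max_(k <= l <= n) (T_l - (l-k)M); the hypotheses say exactly that
   m_0 = 0 and that m_k stays in the run [T_k, T_(k+1)). *)

Require Import Defs.
From HB Require Import structures.
From mathcomp Require Import all_boot all_order all_algebra.
From mathcomp Require Import all_classical all_reals all_analysis.
From mathcomp Require Import zify.

Set Implicit Arguments.
Unset Strict Implicit.
Unset Printing Implicit Defensive.

Import Order.TTheory GRing.Theory Num.Theory.

Local Open Scope classical_set_scope.

(** A discrete intermediate value argument, used to pick the step of an embedding that jumps over a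
    given position. *)
Lemma exists_crossing_step (m : nat -> nat) (N t : nat) :
  m 0 <= t < m N -> exists2 j, j < N & m j <= t < m j.+1.
Proof.
elim: N => [/andP[le0 /(leq_ltn_trans le0)]|N IHN /andP[le0 ltN]].
  by rewrite ltnn.
have [le_mt|lt_tm] := leqP (m N) t; first by exists N; rewrite ?le_mt.
by have [|j ltjN Hj] := IHN; [rewrite le0|exists j => //; apply: ltnW].
Qed.

Lemma hitting_timeS (n : nat) (w : n.-tuple bool) (y : nat -> bool) (k : nat) :
  hitting_finite w y -> k < n ->
  [/\ hitting_time w y k < hitting_time w y k.+1,
      y (hitting_time w y k.+1) = nth false w k &
      forall i, hitting_time w y k < i -> y i = nth false w k ->
        hitting_time w y k.+1 <= i].
Proof.
move=> fin ltkn; have := fin _ ltkn; rewrite /hitting_time /=.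
case: (hitting w y k) => //= t; rewrite /first_after.
case: pselect => //= ex _; case: ex_minnP => p /andP[ltp /eqP yp] minp.
by split=> // i lti yi; apply: minp; rewrite lti yi eqxx.
Qed.

(** Greedy matching is the earliest: if [m] is not ahead of it at one letter, the next value of [m]
    is a candidate in the minimum that defines the next hitting time. *)
Lemma hitting_time_le_embedding (n : nat) (w : n.-tuple bool) (y : nat -> bool)
    (m : nat -> nat) :
  hitting_finite w y ->
  (forall i, i < n -> m i < m i.+1 /\ y (m i.+1) = nth false w i) ->
  forall k, k <= n -> hitting_time w y k <= m k.
Proof.
move=> fin hm; elim=> [|k IHk] // ltkn.
have [_ _ minT] := hitting_timeS fin ltkn; have [ltm ym] := hm _ ltkn.
exact: minT (leq_ltn_trans (IHk (ltnW ltkn)) ltm) ym.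
Qed.

Lemma embedding_step (M a b : nat) :
  1 <= b - a <= M -> a < b /\ b <= a + M.
Proof. by rewrite subn_gt0 leq_subLR => /andP[]. Qed.

Lemma nth_constant_word (n : nat) (a : bool) (i : nat) :
  i < n -> nth false (constant_word n a) i = a.
Proof. by move=> lti; rewrite (nth_mktuple _ _ (Ordinal lti)). Qed.

Lemma nth_alternating_word (n i : nat) :
  i < n -> nth false (alternating_word n) i = ~~ odd i.
Proof. by move=> lti; rewrite (nth_mktuple _ _ (Ordinal lti)). Qed.

(** All letters being equal, the step of [m] that jumps over T_k lands on an [a], hence at or beyond
    T_(k+1), so its length bounds the spacing. Conversely the hitting times themselves form an
    embedding. *)
Lemma constant_seenP (M n : nat) (a : bool) (y : nat -> bool) :
  hitting_finite (constant_word n a) y ->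
  M_seen M (constant_word n a) y <->
  (forall k, 1 <= k <= n -> spacing (constant_word n a) y k <= M).
Proof.
move=> fin; split=> [[m [m0 hm]] [|k] //= ltkn | tauM].
- have leT : hitting_time (constant_word n a) y k.+1 <= m k.+1.
    apply: hitting_time_le_embedding fin _ _ ltkn => i /hm[].
    by case/embedding_step.
  have [ltT _ minT] := hitting_timeS fin ltkn.
  have [|j ltj /andP[lej ltmj]] := @exists_crossing_step m k.+1
    (hitting_time (constant_word n a) y k).
    by rewrite m0 (leq_trans ltT).
  have ltjn := leq_trans ltj ltkn.
  have [/embedding_step[_ lemM] ym] := hm j ltjn.
  rewrite /spacing leq_subLR /=; apply: leq_trans (leq_trans lemM _).
    by apply: minT => //; rewrite ym !nth_constant_word.
  by rewrite leq_add2r.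
- exists (hitting_time (constant_word n a) y); split=> // i ltin.
  have [ltT yT _] := hitting_timeS fin ltin.
  by split=> //; rewrite subn_gt0 ltT; apply: (tauM i.+1).
Qed.

(** The case k = 0 is excluded because T_0 = 0 starts no run: [y 0] is arbitrary. *)
Lemma alternating_run (n : nat) (y : nat -> bool) (k i : nat) :
  hitting_finite (alternating_word n) y -> 0 < k -> k < n ->
  hitting_time (alternating_word n) y k <= i
    < hitting_time (alternating_word n) y k.+1 -> y i = odd k.
Proof.
move=> fin k_gt0 ltkn /andP[leTi ltiT].
have [_ _ minT] := hitting_timeS fin ltkn.
move: leTi; rewrite leq_eqVlt => /predU1P[<-|ltTi].
  case: k k_gt0 ltkn {ltiT minT} => // k _ /ltnW ltkn.
  by have [_ -> _] := hitting_timeS fin ltkn; rewrite nth_alternating_word.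
apply: contraTeq ltiT => yi; rewrite -leqNgt; apply: minT => //.
by rewrite nth_alternating_word //; case: (y i) (odd k) yi => [] [].
Qed.

(** If the conclusion failed first at s+1, then m_(i+s) and m_(i+s+1) would lie in the same run and
    carry equal letters, against alternation. The parities of i and j may differ; 0 < i ensures that
    m_i carries a letter of the word. *)
Lemma alternating_catch_up (n : nat) (y : nat -> bool) (m : nat -> nat)
    (i j s : nat) :
  let T := hitting_time (alternating_word n) y in
  hitting_finite (alternating_word n) y ->
  (forall l, l < n -> m l < m l.+1 /\ y (m l.+1) = ~~ odd l) ->
  0 < i -> 0 < j -> i + s <= n -> j + s <= n ->
  T j <= m i -> T (j + s) <= m (i + s).
Proof.
move=> T fin hm i_gt0 j_gt0; elim: s => [|s IHs]; first by rewrite !addn0.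
rewrite !addnS => ltis ltjs leT.
have {IHs leT} leTm := IHs (ltnW ltis) (ltnW ltjs) leT.
have [ltm ym] := hm _ ltis; rewrite leqNgt; apply/negP => ltmT.
have js_gt0 : 0 < j + s by rewrite addn_gt0 j_gt0.
have y0 : y (m (i + s)) = odd (j + s).
  by apply: (alternating_run fin js_gt0 ltjs); rewrite leTm (ltn_trans ltm).
have y1 : y (m (i + s).+1) = odd (j + s).
  apply: (alternating_run fin js_gt0 ltjs).
  by rewrite (leq_trans leTm (ltnW ltm)).
have ym0 : y (m (i + s)) = odd (i + s).
  case: i i_gt0 ltis {leTm ltm ym ltmT y0 y1} => // i _ ltis.
  by have [_ ->] := hm (i + s) (ltnW ltis); rewrite addSn /=.
by move: y1; rewrite -y0 ym ym0; case: odd.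
Qed.

Lemma alternating_seenP (M n : nat) (y : nat -> bool) :
  0 < M ->
  let T := hitting_time (alternating_word n) y in
  hitting_finite (alternating_word n) y ->
  M_seen M (alternating_word n) y <->
    (forall k, 1 <= k <= n -> T k <= k * M) /\
    (forall j k, j < k <= n -> T k - T j < (k - j + 1) * M).
Proof.
move=> M_gt0 T fin; split=> [[m [m0 hm]] | [leTM ltTM]].
- have hm' l : l < n -> m l < m l.+1 /\ y (m l.+1) = ~~ odd l.
    move=> ltln; have [/embedding_step[]] := hm l ltln.
    by rewrite nth_alternating_word.
  have leTm k : k <= n -> T k <= m k.
    apply: (hitting_time_le_embedding fin) => l ltln.
    by rewrite nth_alternating_word //; apply: hm'.
  have lemM i s : i + s <= n -> m (i + s) <= m i + s * M.
    elim: s => [|s IHs]; first by rewrite addn0 addn0.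
    rewrite addnS => ltis; have [/embedding_step[_ le1] _] := hm _ ltis.
    by have := IHs (ltnW ltis); rewrite mulSn; lia.
  have leTM k : k <= n -> T k <= k * M.
    move=> lekn; apply: leq_trans (leTm k lekn) _.
    by have := lemM 0 k lekn; rewrite m0.
  split=> [k /andP[_]|[|j] k /andP[ltjk lekn]]; first exact: leTM.
    (* For j = 0 the strict bound follows from T_k <= kM and M > 0. *)
    rewrite subn0 subn0 mulnDl mul1n; have := leTM k lekn; lia.
  have ltjn := leq_trans ltjk lekn.
  have [ltT _ _] := hitting_timeS fin (ltnW ltjn).
  (* Crossing T_(j+1) - 1 makes m_(i+1) the first value at or beyond T_(j+1); m_i < T_(j+1) is what
     makes the final bound strict, and i <= j keeps the later indices within n. *)
  have [|i ltij /andP[lti lei]] := @exists_crossing_step m j.+1 (T j.+1).-1.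
    by rewrite m0 /= prednK ?leTm ?(leq_trans _ ltT) // ltnW.
  have ltin : i < n by lia.
  have [/embedding_step[_ le1] _] := hm i ltin.
  have leTi : T j.+1 <= m i.+1 by lia.
  have ltisn : i.+1 + (k - j.+1) <= n by lia.
  have := @alternating_catch_up n y m i.+1 j.+1 (k - j.+1) fin hm' isT isT
    ltisn.
  rewrite subnKC ?(ltnW ltjk) // => /(_ lekn leTi).
  have := lemM _ _ ltisn; rewrite -/T.
  have : 0 < T j.+1 by rewrite (leq_trans _ ltT).
  rewrite mulnDl mul1n; move: ((k - j.+1) * M) => q; lia.
(* Truncating negative terms to 0 is harmless for k <= n, since the term l = k is T_k >= 0. *)
pose m k := \max_(l < n.+1 | k <= l) (T l - (l - k) * M).
have m_ge k l : k <= l <= n -> T l - (l - k) * M <= m k.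
  move=> /andP[lekl leln]; have ltln : l < n.+1 by [].
  exact: (@leq_bigmax_cond _ _ (fun l : 'I_n.+1 => T l - (l - k) * M)
    (Ordinal ltln)).
have leTm k : k <= n -> T k <= m k.
  by move=> lekn; have := m_ge k k; rewrite leqnn lekn subnn mul0n subn0 => ->.
have m_run k : k < n -> m k < T k.+1.
  move=> ltkn; have [ltT _ _] := hitting_timeS fin ltkn.
  rewrite -/T in ltT; suff : m k <= (T k.+1).-1 by lia.
  apply/bigmax_leqP => -[l ltl] /= lekl.
  (* The term l = k is below T_(k+1) by monotonicity, l = k+1 because M > 0, and l > k+1 by the
     hypothesis for the pair (k+1, l). *)
  have [eql|ltkl] := leqP l k; first by rewrite (_ : l = k); lia.
  have [lel|ltkl'] := leqP l k.+1.
    by rewrite (_ : l = k.+1) ?subSnn; lia.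
  have := ltTM k.+1 l; rewrite ltkl' -ltnS ltl => /(_ isT).
  have -> : l - k.+1 + 1 = l - k by lia.
  by move: ((l - k) * M) => q; lia.
exists m; split.
  apply/eqP; rewrite -leqn0; apply/bigmax_leqP => -[[|l] ltl] _ //=.
  by rewrite leqn0 subn_eq0 subn0; apply: leTM.
move=> i ltin; have [_ yT _] := hitting_timeS fin ltin.
rewrite subn_gt0 leq_subLR (leq_trans (m_run i ltin)) ?leTm //=; split.
  (* Steps are at most M: passing from i+1 to i lowers each term by at most M. *)
  apply/bigmax_leqP => -[l ltl] /= ltil; have := m_ge i l.
  rewrite (ltnW ltil) -ltnS ltl.
  move=> /(_ isT); have -> : l - i = (l - i.+1).+1 by lia.
  rewrite mulSn; lia.
rewrite nth_alternating_word //.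
(* The last letter is treated apart: no T_(n+1) closes its run, but m_n = T_n. *)
move: ltin; rewrite leq_eqVlt => /predU1P[eqn|ltin1].
  have -> : m i.+1 = T i.+1.
    apply/eqP; rewrite eqn_leq leTm ?eqn // andbT.
    apply/bigmax_leqP => -[l ltl] /= lel.
    have -> : l = n by lia.
    by rewrite subnn subn0.
  by rewrite yT nth_alternating_word // -eqn.
by apply: (@alternating_run n y i.+1) => //; rewrite leTm ?m_run // ltnW.
Qed.

Theorem theorem3 (R : realType) (d : measure_display) (Omega : measurableType d)
    (P : probability Omega R) (Y : nat -> {RV P >-> bool})
    (Yindep : mutually_independent [set j : nat | 0 < j] Y)
    (Yhalf : forall j, 0 < j -> P [set omega | Y j omega = true] = (2^-1)%R%:E)
    (M n : nat) (M_gt0 : 0 < M) (n_gt0 : 0 < n) :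
  (forall (a : bool) (omega : Omega),
     let W := constant_word n a in
     let y := fun j => Y j omega in
     hitting_finite W y ->
     M_seen M W y <-> (forall k, 1 <= k <= n -> spacing W y k <= M))
  /\
  (forall omega : Omega,
     let A := alternating_word n in
     let y := fun j => Y j omega in
     let T := hitting_time A y in
     hitting_finite A y ->
     M_seen M A y <->
       (forall k, 1 <= k <= n -> T k <= k * M) /\
       (forall j k, j < k <= n -> T k - T j < (k - j + 1) * M)).
Proof.
split=> [a|] omega /= fin; first exact: constant_seenP.
exact: alternating_seenP.
Qed.
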